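(* Let $D=\{z\in\mathbb{C}:|z-1/2|\le1/2\}$ and let $U\subset\mathbb{R}^2=\mathbb{C}$ be a bounded, mildly regular open set with $\operatorname{int}(D)\subset U$, $U\supset D$... more precisely $\bar U\supset D$, $x>0$ on $U$, and $0\le x\le1$, $|y|\le1/2$ for all $(x,y)\in\bar U$. Let $\mathcal{B}$ be an infinite subset of $I_1:=\{m+n\mathrm{i}:m\in\mathbb{N},n\in\mathbb{Z}\}$, $\theta_b(z)=1/(z+b)$, let $\tau(\mathcal{B})=\inf\{t>0:\sum_{b\in\mathcal{B}}|b|^{-2t}<\infty\}$, let $s>\tau(\mathcal{B})$, and let $v_s$ be the (unique up to scalar multiples) strictly positive continuous eigenfunction on $\bar U$ of $(L_sf)(z)=\sum_{b\in\mathcal{B}}|z+b|^{-2s}f(\theta_b(z))$. Let $R>2$ and $$C(R,s)=\exp\Big(\frac{-\sqrt5s}{\sqrt{R^2-R}}\Big)\Big(\frac{R}{R+\sqrt5+5/(4R)}\Big)^s.$$ Then for all $z\in\bar U$, $$\sum_{b\in\mathcal{B},|b|>R}\frac{v_s(\theta_b(z))}{|z+b|^{2s}}\ge C(R,s)v_s(0)\sum_{b\in\mathcal{B},|b|>R}\frac{1}{|b|^{2s}}.$$ Moreover, with $\theta_R=\arcsin(1/(R+\sqrt2))$: if $\mathcal{B}=I_1$ and $s>1$, then for all $z\in\bar U$ $$\sum_{b\in I_1,|b|>R}\frac{v_s(\theta_b(z))}{|z+b|^{2s}}\ge C(R,s)v_s(0)(\pi-2\theta_R)\frac{1}{2s-2}\Big(\frac{1}{R+\sqrt2}\Big)^{2s-2};$$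 and if $\mathcal{B}=I_2:=\{m+n\mathrm{i}:m\in\mathbb{N},n\in\mathbb{Z},n<0\}$ and $s>1$, then for all $z\in\bar U$ $$\sum_{b\in I_2,|b|>R}\frac{v_s(\theta_b(z))}{|z+b|^{2s}}\ge C(R,s)v_s(0)(\pi/2-2\theta_R)\frac{1}{2s-2}\Big(\frac{1}{R+\sqrt2}\Big)^{2s-2}.$$
   Context: A bounded open set $H\subset\mathbb{R}^n$ is mildly regular if there exist $\eta>0$ and $M\ge1$ such that whenever $x,y\in H$ and $\|x-y\|<\eta$, there is a Lipschitz map $\psi:[0,1]\to H$ with $\psi(0)=x$, $\psi(1)=y$ and $\int_0^1\|\psi'(t)\|\,dt\le M\|x-y\|$. $\mathbb{N}=\{1,2,\dots\}$. *)

(* Defs.v *)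
From HB Require Import structures.
From mathcomp Require Import all_boot all_order all_algebra.
From mathcomp Require Import all_classical all_reals all_analysis.
Set Implicit Arguments. Unset Strict Implicit. Unset Printing Implicit Defensive.
Import Order.TTheory GRing.Theory Num.Theory.
Import numFieldNormedType.Exports.
Local Open Scope classical_set_scope.
Local Open Scope ring_scope.

Section defs.
Variable R : realType.
Local Notation C := (R * R)%type.

Definition ptadd (z w : C) : C := (z.1 + w.1, z.2 + w.2).
Definition ptsub (z w : C) : C := (z.1 - w.1, z.2 - w.2).
Definition ptmod (z : C) : R := Num.sqrt (z.1 ^+ 2 + z.2 ^+ 2).
Definition ptinv (z : C) : C :=
  (z.1 / (z.1 ^+ 2 + z.2 ^+ 2), - z.2 / (z.1 ^+ 2 + z.2 ^+ 2)).

Definition theta (b z : C) : C := ptinv (ptadd z b).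

Definition I1 : set C :=
  [set b | exists (m : nat) (n : int), (0 < m)%N /\ b = (m%:R, n%:~R)].
Definition I2 : set C :=
  [set b | exists (m : nat) (n : int), (0 < m)%N /\ (n < 0)%R /\ b = (m%:R, n%:~R)].

Definition tau (B : set C) : \bar R :=
  ereal_inf [set t%:E | t in [set t : R | 0 < t /\
     (\esum_(b in B) ((ptmod b) `^ (- (2 * t)))%:E < +oo)%E]].

Definition Lop (B : set C) (s : R) (f : C -> R) (z : C) : \bar R :=
  \esum_(b in B) ((ptmod (ptadd z b)) `^ (- (2 * s)) * f (theta b z))%:E.

Definition Ddisc : set C := [set z | ptmod (ptsub z (2^-1, 0)) <= 2^-1].

Definition bounded_C (H : set C) : Prop := exists K : R, forall p, H p -> ptmod p <= K.

Definition speed (psi : R -> C) (t : R) : R :=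
  Num.sqrt ((derive1 (fun u => (psi u).1) t) ^+ 2 + (derive1 (fun u => (psi u).2) t) ^+ 2).

Definition lipschitz_on01 (psi : R -> C) : Prop :=
  exists K : R, forall t1 t2, 0 <= t1 <= 1 -> 0 <= t2 <= 1 ->
    ptmod (ptsub (psi t1) (psi t2)) <= K * `|t1 - t2|.

Definition mildly_regular (H : set C) : Prop :=
  bounded_C H /\ open H /\
  exists (eta M : R), 0 < eta /\ 1 <= M /\
    forall x y, H x -> H y -> ptmod (ptsub x y) < eta ->
      exists psi : R -> C,
        [/\ psi 0 = x, psi 1 = y,
            (forall t, 0 <= t <= 1 -> H (psi t)),
            lipschitz_on01 psi &
            (\int[lebesgue_measure]_(t in `[0%R, 1%R]%classic) (speed psi t)%:E
               <= (M * ptmod (ptsub x y))%:E)%E].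

Definition pos_eigenfunction (U : set C) (B : set C) (s : R) (v : C -> R) : Prop :=
  {within closure U, continuous v} /\
  (forall z, closure U z -> 0 < v z) /\
  exists lam : R, forall z, closure U z -> Lop B s v z = (lam * v z)%:E.

Definition CRs (Rr s : R) : R :=
  expR (- (Num.sqrt 5 * s) / Num.sqrt (Rr ^+ 2 - Rr)) *
  (Rr / (Rr + Num.sqrt 5 + 5 / (4 * Rr))) `^ s.

Definition thetaR (Rr : R) : R := asin (1 / (Rr + Num.sqrt 2)).

End defs.

(* Main.v *)
Require Import Defs.
From HB Require Import structures.
From mathcomp Require Import all_boot all_order all_algebra.
From mathcomp Require Import all_classical all_reals all_analysis.
From mathcomp Require Import measurable_realfun.
From mathcomp Require Import ring lra zify.

(** The operator transports the inequality |w + u|^2 <= mu |z + u|^2 (for all u with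
    Re u >= 1) from the pair (z, w) to the pairs (theta_b z, theta_b w), with mu multiplied by
    |z + b|^2 / |w + b|^2, which is exactly the ratio of the weights. Since the
    maps theta_b bring the points of D together and v is uniformly continuous on D, iterating the
    eigenvalue equation yields v z <= mu^s v w. With z = 0 this is
    v 0 <= (1 + |w|)^(2s) v w <= exp (2s |w|) v w, and the first estimate holds term by term.

    For the explicit constants, the area integral of |z|^(-2s) over a sector
    rho <= |z|, T0 <= y/x <= T1, computed in the coordinates (x, y/x), is compared with the
    lattice sum cell by cell. Bounding the integrand by its value at the corner of the cell
    nearest to 0 suffices for I_2. For I_1 the row n = 0 is shared by the two quadrants and may
    only be used with weight 1/2: in the cell [m, m+1[ x [n, n+1[ the integrand is bounded by
    a chord between its values at (m, n) and (m, n+1), whose parameter is x - m for n < m and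
    y - n for n >= m, so that the integral is at most the mean of the two values. *)

Set Implicit Arguments. Unset Strict Implicit. Unset Printing Implicit Defensive.
Import Order.TTheory GRing.Theory Num.Theory.
Import numFieldNormedType.Exports.
Local Open Scope classical_set_scope.
Local Open Scope ring_scope.

(** * Squared moduli, the lattice, and invariance of the disc D *)

Section plane.
Variable R : realType.
Local Notation C := (R * R)%type.
Implicit Types (z w b : C).

Definition sqN z : R := z.1 ^+ 2 + z.2 ^+ 2.

Lemma sqN_ge0 z : 0 <= sqN z.
Proof. by rewrite /sqN addr_ge0 ?sqr_ge0. Qed.

Lemma ptmodE z : ptmod z = Num.sqrt (sqN z).
Proof. by []. Qed.

Lemma ptmod_ge0 z : 0 <= ptmod z.
Proof. exact: sqrtr_ge0. Qed.

Lemma sqr_ptmod z : ptmod z ^+ 2 = sqN z.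
Proof. by rewrite ptmodE sqr_sqrtr ?sqN_ge0. Qed.

Lemma ptmod_powR z s : ptmod z `^ (- (2 * s)) = sqN z `^ (- s).
Proof.
rewrite ptmodE -powR12_sqrt ?sqN_ge0// -powRrM; congr (_ `^ _).
by rewrite mulrN mulrA mulVf ?mul1r// pnatr_eq0.
Qed.

Lemma DdiscE z : Ddisc z <-> sqN z <= z.1.
Proof.
rewrite /Ddisc /= /ptmod /ptsub /sqN /= subr0.
have -> : (2^-1 : R) = Num.sqrt (2^-1 ^+ 2) by rewrite sqrtr_sqr ger0_norm ?invr_ge0.
rewrite ler_sqrt ?sqr_ge0// sqrtr_sqr ger0_norm ?invr_ge0//.
by split => h; lra.
Qed.

Lemma sqN_gt0 w : 1 <= w.1 -> 0 < sqN w.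
Proof. by move=> h; rewrite /sqN; nra. Qed.

Lemma sqN_ptinv w : 1 <= w.1 -> sqN (ptinv w) = (sqN w)^-1.
Proof.
move=> /sqN_gt0; rewrite /ptinv /sqN /= => h.
by field; rewrite gt_eqF.
Qed.

Lemma I1_re b : I1 b -> 1 <= b.1.
Proof. by move=> [m [n [m0 ->]]] /=; rewrite ler1n. Qed.

Lemma I2_sub_I1 : @I2 R `<=` @I1 R.
Proof. by move=> b [m [n [m0 [n0 ->]]]]; exists m, n. Qed.

Lemma int_sqr_ge_norm (n : int) : `|n%:~R : R| <= n%:~R ^+ 2.
Proof.
rewrite -[n%:~R ^+ 2]real_normK ?num_real// -intr_norm.
have [->|n0] := eqVneq n 0; first by rewrite normr0 expr0n.
have : 1 <= `|n|%:~R :> R by rewrite ler1z -gtz0_ge1 normr_gt0.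
by move: (`|n|%:~R : R) => x; nra.
Qed.

(** Integrality of Im b enters here: (Im b)^2 will absorb the cross term 2 Im z Im b, which is at
    most |Im b| in modulus when |Im z| <= 1/2. *)
Lemma I1_im b : I1 b -> `|b.2| <= b.2 ^+ 2.
Proof. by move=> [m [n [m0 ->]]] /=; exact: int_sqr_ge_norm. Qed.

(** Inversion maps the half-plane Re w >= 1 into D: membership of 1/w reads 1/|w|^2 <= Re
    w/|w|^2. *)
Lemma theta_disc b z : I1 b -> 0 <= z.1 -> Ddisc (theta b z).
Proof.
move=> /I1_re b1 z1; have w1 : 1 <= (ptadd z b).1 by rewrite /=; lra.
apply/DdiscE; rewrite /theta sqN_ptinv// /= -/(sqN (ptadd z b)).
by rewrite ler_peMl ?invr_ge0 ?sqN_ge0.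
Qed.

End plane.

(** * Compactness of D and uniform continuity in multiplicative form *)

Section compactness.
Variable R : realType.
Local Notation C := (R * R)%type.
Implicit Types (z w b : C).

Lemma closed_Ddisc : closed (@Ddisc R).
Proof.
rewrite (_ : @Ddisc R = (fun z : C => sqN z - z.1) @^-1` [set x | x <= 0]).
  apply: closed_comp (@closed_le R 0) => z _.
  rewrite /sqN; apply: cvgB; last exact: cvg_fst.
  by apply: cvgD; apply: cvgM; (exact: cvg_fst || exact: cvg_snd).
by apply/seteqP; split => z; rewrite /= ?subr_le0 => /DdiscE.
Qed.

Lemma compact_Ddisc : compact (@Ddisc R).
Proof.
have -> : @Ddisc R = (`[0%R, 1%R] `*` `[(-1)%R, 1%R]) `&` @Ddisc R.
  apply/seteqP; split => [z /= Dz|z []//]; split=> //.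
  move/DdiscE: Dz; rewrite /sqN /= !in_itv /=; move: z.1 z.2 => x y h.
  have := sqr_ge0 (x - 2^-1); have := sqr_ge0 x; have := sqr_ge0 y => ? ? ?.
  by split; apply/andP; split; nra.
by apply: compact_closedI closed_Ddisc; apply: compact_setX; exact: segment_compact.
Qed.

(** Closeness is measured by an integer [M] with M |z - w|^2 <= 1, because each application of a map
    [theta b] raises this integer by one. *)
Lemma uniform_ratio (D : set C) (v : C -> R) (e : R) :
  compact D -> {within D, continuous v} -> (forall z, D z -> 0 < v z) -> 0 < e ->
  exists M : nat, forall z w, D z -> D w -> M%:R * sqN (ptsub z w) <= 1 ->
    v z <= (1 + e) * v w.
Proof.
move=> /compact_near_coveringP cD /subspace_continuousP cv v0 e0.
have := cD nat \oo (fun M z => D z -> forall w, D w -> M%:R * sqN (ptsub z w) <= 1 ->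
  v z <= (1 + e) * v w) _.
case=> [x Dx|M _ HM]; last by exists M => z w Dz; exact: (HM M (leqnn M) z Dz Dz).
have vx := v0 x Dx.
(* The witness solves v x + h = (1 + e)(v x - h), so an oscillation of [h] around [v x] costs at
   most a factor 1 + e. *)
have [h h0 hE] : exists2 h, 0 < h & v x + h <= (1 + e) * (v x - h).
  exists (e * v x / (2 + e)); first by rewrite divr_gt0 ?mulr_gt0 ?addr_gt0.
  by rewrite le_eqVlt; apply/orP; left; apply/eqP; field; rewrite gt_eqF//; lra.
have /nbhs_ballP[d /= d0 Hd] : nbhs x [set z | D z -> `|v x - v z| < h].
  exact: cv x Dx (ball (v x) h) (nbhsx_ballx _ _ h0).
have HB z : ball x d z -> D z -> `|v x - v z| < h by move=> ? ?; exact: Hd.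
have d20 : 0 < d / 2 by rewrite divr_gt0.
(* With this bound on [M], M |z - w|^2 <= 1 gives |z - w| < d/2, and the half radius around [x]
   leaves room for [w] in the ball of radius [d]. *)
exists (ball x (d / 2), [set M | (2 / d) ^+ 2 < M%:R]).
  by split; [exact: nbhsx_ballx | exact: nbhs_infty_gtr].
move=> [z M] [/= xz HM] Dz w Dw zw.
have vz : `|v x - v z| < h by apply: HB => //; apply: le_ball xz; lra.
have zwd : sqN (ptsub z w) < (d / 2) ^+ 2.
  have M0 : 0 < M%:R :> R by apply: le_lt_trans HM; rewrite sqr_ge0.
  rewrite -(ltr_pM2l M0); apply: (le_lt_trans zw).
  rewrite -invf_div exprVn -ltr_pdivrMr; last by rewrite invr_gt0 exprn_gt0// divr_gt0.
  by rewrite invrK mul1r.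
(* Balls of the product are those of the sup norm, so the Euclidean bound is used in each
   coordinate. *)
have bzw : ball z (d / 2) w.
  rewrite /sqN /ptsub /= in zwd.
  by split; rewrite /ball/= -(ltr_pXn2r (n := 2)) ?nnegrE ?(ltW d20)// real_normK ?num_real//;
    apply: le_lt_trans zwd; rewrite ?lerDl ?lerDr sqr_ge0.
have vw : `|v x - v w| < h.
  by apply: HB => //; rewrite [d]splitr; exact: ball_triangle bzw.
move: vz vw; rewrite !ltr_norml => /andP[? ?] /andP[? ?].
have : (1 + e) * (v x - h) <= (1 + e) * v w by rewrite ler_pM2l; lra.
lra.
Qed.

End compactness.

(** * Contraction and distortion under the maps [theta b] *)

Section log_lipschitz.
Variable R : realType.
Local Notation C := (R * R)%type.
Implicit Types (z w b : C).

(** Expand |z + b|^2: on D one has Re z >= |z|^2, so 2 Re z Re b >= 2 |z|^2; the cross term 2 Im z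
    Im b is at least -|Im b| >= -(Im b)^2; and (Re b)^2 >= 1. *)
Lemma sqN_disc_shift z b : Ddisc z -> I1 b -> 1 + 3 * sqN z <= sqN (ptadd z b).
Proof.
move=> /DdiscE Dz Ib; have b1 := I1_re Ib; have b2 := I1_im Ib.
have : `|z.2| <= 2^-1.
  move: Dz; rewrite /sqN -real_normK ?num_real// -[z.2 ^+ 2]real_normK ?num_real//.
  rewrite real_normK ?num_real//; move: (normr_ge0 z.2) (sqr_ge0 (z.1 - 2^-1)).
  by move: `|z.2| => y; nra.
have zb : - (`|z.2| * `|b.2|) <= z.2 * b.2.
  by rewrite -normrM lerNl; apply: le_trans (ler_norm _) _; rewrite normrN.
have := normr_ge0 b.2; have := normr_ge0 z.2; move: Dz zb b2.
rewrite /sqN /ptadd /=; move: `|z.2| `|b.2| => p q Dz zb b2 p0 q0 p2.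
have : p * q <= q / 2 by nra.
have z10 : 0 <= z.1 by have := sqr_ge0 z.1; have := sqr_ge0 z.2; lra.
nra.
Qed.

Lemma sqN_sub_le z w : sqN (ptsub z w) <= 2 * sqN z + 2 * sqN w.
Proof.
rewrite /sqN /ptsub /=.
have := sqr_ge0 (z.1 + w.1); have := sqr_ge0 (z.2 + w.2); nra.
Qed.

Lemma sqN_theta_sub b z w : 1 <= (ptadd z b).1 -> 1 <= (ptadd w b).1 ->
  sqN (ptsub (theta b z) (theta b w)) =
  sqN (ptsub z w) / (sqN (ptadd z b) * sqN (ptadd w b)).
Proof.
move=> z1 w1; have := sqN_gt0 z1; have := sqN_gt0 w1.
rewrite /sqN /theta /ptinv /ptsub /ptadd /= => h1 h2.
by field; rewrite !gt_eqF.
Qed.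

(** There is no uniform contraction ratio, as the derivative of [theta b] at 0 has modulus 1 for b =
    1. Instead 1/|z - w|^2 grows by at least 1: for d = |z - w|^2, the product |z + b|^2 |w + b|^2
    is at least 1 + 3|z|^2 + 3|w|^2 >= 1 + d, so the new squared distance is at most d/(1 + d). *)
Lemma theta_sub_contract (j : nat) b z w : Ddisc z -> Ddisc w -> I1 b ->
  j%:R * sqN (ptsub z w) <= 1 ->
  j.+1%:R * sqN (ptsub (theta b z) (theta b w)) <= 1.
Proof.
move=> Dz Dw Ib hj.
have Dre u : Ddisc u -> 1 <= (ptadd u b).1.
  move=> /DdiscE; have := sqN_ge0 u; have := I1_re Ib.
  by rewrite /ptadd /= => ? ? ?; lra.
rewrite sqN_theta_sub ?Dre// mulrA ler_pdivrMr ?mulr_gt0 ?sqN_gt0 ?Dre// mul1r.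
have := sqN_disc_shift Dz Ib; have := sqN_disc_shift Dw Ib.
have := sqN_sub_le z w; have := sqN_ge0 z; have := sqN_ge0 w.
move: hj; rewrite -natr1 mulrDl mul1r.
move: (sqN (ptsub z w)) (sqN (ptadd z b)) (sqN (ptadd w b)) (sqN z) (sqN w).
move=> d p q x y hj y0 x0 hd hq hp.
suff : (1 + 3 * x) * (1 + 3 * y) <= p * q by nra.
by apply: ler_pM; lra.
Qed.

(** This is the factorization 1/(z + b) + w = w (z + b + 1/w)/(z + b). *)
Lemma sqN_theta_add b z w : 1 <= (ptadd z b).1 -> 0 < sqN w ->
  sqN (ptadd (theta b z) w) =
  sqN w * sqN (ptadd z (ptadd b (ptinv w))) / sqN (ptadd z b).
Proof.
move=> /sqN_gt0; rewrite /sqN /theta /ptinv /ptadd /= => h1 h2.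
by field; rewrite !gt_eqF.
Qed.

(** By the factorization, testing the image pair against [u] amounts to testing (z, w) against b +
    1/u, which is again allowed because Re (1/u) >= 0. Quantifying over all [u] is what makes the
    inequality stable under iteration. *)
Lemma distortion_step (mu : R) b z w : 1 <= (ptadd z b).1 -> 1 <= (ptadd w b).1 ->
  1 <= b.1 ->
  (forall u, 1 <= u.1 -> sqN (ptadd w u) <= mu * sqN (ptadd z u)) ->
  forall u, 1 <= u.1 -> sqN (ptadd (theta b w) u) <=
    mu * sqN (ptadd z b) / sqN (ptadd w b) * sqN (ptadd (theta b z) u).
Proof.
move=> z1 w1 b1 H u u1; have u0 := sqN_gt0 u1.
have zp := sqN_gt0 z1; have wp := sqN_gt0 w1.
rewrite !sqN_theta_add//.
have := H (ptadd b (ptinv u)).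
have -> : 1 <= (ptadd b (ptinv u)).1.
  rewrite /= -/(sqN u); have : 0 <= u.1 / sqN u by rewrite divr_ge0 ?sqN_ge0//; lra.
  lra.
move=> /(_ isT).
move: (sqN (ptadd z (ptadd _ _))) (sqN (ptadd w (ptadd _ _))) => p q pq.
have -> : mu * sqN (ptadd z b) / sqN (ptadd w b) * (sqN u * p / sqN (ptadd z b)) =
  (mu * p) * (sqN u / sqN (ptadd w b)) by field; rewrite !gt_eqF.
rewrite mulrAC [leLHS]mulrC ler_wpM2r// divr_ge0// ltW//.
Qed.

Lemma le_esum_subset (T : choiceType) (A B : set T) (a : T -> \bar R) :
  A `<=` B -> (forall x, B x -> (0 <= a x)%E) ->
  (\esum_(x in A) a x <= \esum_(x in B) a x)%E.
Proof.
move=> AB a0; rewrite esum_mkcond [leRHS]esum_mkcond; apply: le_esum => x _.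
case: ifPn => [/set_mem/AB Bx|_]; first by rewrite mem_set.
by case: ifPn => // /set_mem /a0.
Qed.

(** A single term of the series is already positive. The sign lets [lam] be cancelled from
    inequalities between values of the operator. *)
Lemma eigenvalue_gt0 (U B : set C) (s lam : R) (v : C -> R) z :
  B `<=` @I1 R -> B !=set0 -> (forall z, closure U z -> 0 < v z) ->
  @Ddisc R `<=` closure U -> Ddisc z ->
  Lop B s v z = (lam * v z)%:E -> 0 < lam.
Proof.
move=> BI [b Bb] v0 DU Dz eL.
have z10 : 0 <= z.1 by move/DdiscE: Dz; have := sqN_ge0 z; lra.
have tv b' : B b' -> 0 < v (theta b' z).
  by move=> Bb'; apply/v0/DU/theta_disc => //; exact: BI.
suff : (0 < Lop B s v z)%E by rewrite eL lte_fin pmulr_lgt0// v0//; exact: DU.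
apply: (@lt_le_trans _ _ ((ptmod (ptadd z b)) `^ (- (2 * s)) * v (theta b z))%:E).
  rewrite lte_fin mulr_gt0 ?tv// ptmod_powR powR_gt0// sqN_gt0//=.
  by have := I1_re (BI _ Bb); lra.
rewrite -[leLHS](@esum_set1 _ _ b (fun b => ((ptmod (ptadd z b)) `^ (- (2 * s)) *
  v (theta b z))%:E)); last first.
  by rewrite lee_fin mulr_ge0 ?powR_ge0// ltW ?tv.
apply: le_esum_subset => [x ->//|x Bx].
by rewrite lee_fin mulr_ge0 ?powR_ge0// ltW ?tv.
Qed.

End log_lipschitz.

(** * Iterating the eigenvalue equation: a Harnack inequality on D *)

Lemma le_esumZ (R : realType) (T : choiceType) (A : set T) (a b : T -> \bar R) (c : R) :
  0 <= c -> (forall x, A x -> (0 <= b x)%E) ->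
  (forall x, A x -> (a x <= c%:E * b x)%E) ->
  (\esum_(x in A) a x <= c%:E * \esum_(x in A) b x)%E.
Proof.
move=> c0 b0 ab; rewrite esum_mkcond [in leRHS]esum_mkcond.
rewrite ge_ereal_sup// => _ [X [finX XA] <-].
pose b' x := if x \in A then b x else 0%E.
have b'0 x : (0 <= b' x)%E by rewrite /b'; case: ifPn => // /set_mem /b0.
apply: (@le_trans _ _ (\sum_(x \in X) c%:E * b' x)%E).
  apply: lee_fsum => // x _; rewrite /b'; case: ifPn => [/set_mem /ab//|_].
  by rewrite mule0.
rewrite -ge0_mule_fsumr// lee_wpmul2l ?lee_fin//.
by apply: esum_ge; exists X => //; split.
Qed.

Section harnack.
Variables (R : realType) (U B : set (R * R)) (s : R) (v : R * R -> R).
Local Notation C := (R * R)%type.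
Implicit Types (z w b : C).
Hypotheses (BI : B `<=` @I1 R) (B0 : B !=set0) (s0 : 0 <= s).
Hypotheses (DU : @Ddisc R `<=` closure U) (v_eig : pos_eigenfunction U B s v).

Let Dre z : Ddisc z -> 0 <= z.1.
Proof. by move/DdiscE => h; apply: le_trans h; exact: sqN_ge0. Qed.

Let v_gt0 z : Ddisc z -> 0 < v z.
Proof. by move=> /DU; case: v_eig => _ [+ _]; exact. Qed.

Lemma harnack_step (c mu : R) z w : Ddisc z -> Ddisc w -> 0 <= c -> 0 <= mu ->
  (forall b, B b -> v (theta b z) <=
    c * (mu * sqN (ptadd z b) / sqN (ptadd w b)) `^ s * v (theta b w)) ->
  v z <= c * mu `^ s * v w.
Proof.
move=> Dz Dw c0 mu0 H; have [_ [vpos [lam eL]]] := v_eig.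
have lam0 : 0 < lam.
  exact: (eigenvalue_gt0 BI B0 vpos DU Dz (eL _ (DU Dz))).
rewrite -(ler_pM2l lam0) -lee_fin -(eL _ (DU Dz)).
have -> : ((lam * (c * mu `^ s * v w))%:E = (c * mu `^ s)%:E * Lop B s v w)%E.
  by rewrite (eL _ (DU Dw)) -EFinM; congr (_%:E); ring.
have B1 b u : B b -> Ddisc u -> 1 <= (ptadd u b).1.
  by move=> /BI /I1_re ? /Dre ?; rewrite /=; lra.
have tD b u : B b -> Ddisc u -> Ddisc (theta b u).
  by move=> /BI Ib /Dre; exact: theta_disc.
apply: le_esumZ; first by rewrite mulr_ge0 ?powR_ge0.
  by move=> b Bb; rewrite lee_fin mulr_ge0 ?powR_ge0// ltW// v_gt0//; exact: tD.
move=> b Bb; rewrite -EFinM lee_fin !ptmod_powR.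
have z0 := sqN_gt0 (B1 _ _ Bb Dz); have w0 := sqN_gt0 (B1 _ _ Bb Dw).
apply: le_trans (_ : sqN (ptadd z b) `^ (- s) * (c *
  (mu * sqN (ptadd z b) / sqN (ptadd w b)) `^ s * v (theta b w)) <= _).
  by rewrite ler_wpM2l ?powR_ge0// H.
rewrite powRM ?mulr_ge0 ?invr_ge0 ?(ltW z0) ?(ltW w0)//.
rewrite powRM ?(ltW z0)// -powR_inv1 ?(ltW w0)// -powRrM mulN1r.
rewrite [sqN (ptadd z b) `^ (- s)]powRN le_eqVlt; apply/orP; left; apply/eqP.
by field; rewrite gt_eqF// powR_gt0.
Qed.

Lemma harnack (mu : R) z w : Ddisc z -> Ddisc w -> 1 <= mu ->
  (forall u, 1 <= u.1 -> sqN (ptadd w u) <= mu * sqN (ptadd z u)) ->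
  v z <= mu `^ s * v w.
Proof.
move=> Dz Dw mu1 Hmu.
(* A loss of 1 + e is allowed for every e > 0 and removed in the limit. *)
suff H e : 0 < e -> v z <= (1 + e) * mu `^ s * v w.
  have a0 : 0 < mu `^ s * v w by rewrite mulr_gt0 ?v_gt0// powR_gt0//; lra.
  apply/ler_addgt0Pr => e e0.
  have := H (e / (mu `^ s * v w)) (divr_gt0 e0 a0).
  by rewrite -mulrA mulrDl mul1r divfK// gt_eqF.
move=> e0; have [cv [vpos _]] := v_eig.
have cvD : {within @Ddisc R, continuous v} by exact: continuous_subspaceW cv.
have [M HM] := uniform_ratio (@compact_Ddisc R) cvD v_gt0 e0.
(* Here [k] counts the remaining applications of the equation. At k = M the closeness condition is
   void; at k = 0 it is that of [uniform_ratio], the only place where the factor 1 + e is spent. *)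
suff H k : forall mu z w, Ddisc z -> Ddisc w -> 1 <= mu ->
    (forall u, 1 <= u.1 -> sqN (ptadd w u) <= mu * sqN (ptadd z u)) ->
    (M - k)%:R * sqN (ptsub z w) <= 1 -> v z <= (1 + e) * mu `^ s * v w.
  by apply: (H M) => //; rewrite subnn mul0r.
elim: k => [|k IH] {}mu {}z {}w {}Dz {}Dw {}mu1 {}Hmu.
  rewrite subn0 => /(HM _ _ Dz Dw) /le_trans; apply.
  rewrite ler_wpM2r ?(ltW (v_gt0 _))// ler_peMr; [by []|lra|].
  by rewrite -(powRr0 mu) ler_powR.
(* Subtraction is truncated: if M - k = 0, the condition at [k] is void too and the induction
   hypothesis applies to (z, w) itself. *)
rewrite subnS; have [Mk|Mk] := posnP (M - k).
  by move=> _; apply: IH => //; rewrite Mk mul0r.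
move=> hj; apply: harnack_step => //; [lra|lra|] => b Bb.
have Ib := BI Bb; have b1 := I1_re Ib.
have Dre1 u : Ddisc u -> 1 <= (ptadd u b).1 by move/Dre => ?; rewrite /=; lra.
apply: IH; [exact/theta_disc/Dre|exact/theta_disc/Dre| | |].
(* The new multiplier is at least 1 by [Hmu] at u = b. *)
- by rewrite ler_pdivlMr ?sqN_gt0 ?Dre1// mul1r Hmu.
- by apply: distortion_step => //; exact: Dre1.
- by rewrite -(prednK Mk); exact: theta_sub_contract.
Qed.

Lemma harnack0 z : Ddisc z -> v (0, 0) <= expR (2 * s * ptmod z) * v z.
Proof.
move=> Dz; have m0 := ptmod_ge0 z.
have D0 : Ddisc (0 : R, 0 : R) by apply/DdiscE; rewrite /sqN /= expr0n/= addr0.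
(* The multiplier comes from |z + u| <= |z| + |u| <= (1 + |z|) |u|, as |u| >= Re u >= 1. *)
apply: le_trans (_ : ((1 + ptmod z) ^+ 2) `^ s * v z <= _).
  apply: harnack => //; first by rewrite expr_ge1//; lra.
  move=> u u1; rewrite -(sqr_ptmod (ptadd _ _)) -[sqN (ptadd (0, 0) u)]sqr_ptmod -exprMn.
  have -> : ptadd (0, 0) u = u by rewrite /ptadd /= !add0r -surjective_pairing.
  have pu : 1 <= ptmod u.
    by rewrite ptmodE -sqrtr1 ler_sqrt ?sqN_ge0// /sqN; nra.
  rewrite lerXn2r ?nnegrE ?ptmod_ge0 ?mulr_ge0 ?addr_ge0 ?ptmod_ge0//.
  apply: (@le_trans _ _ (ptmod z + ptmod u)); last by nra.
  rewrite -ler_sqr ?nnegrE ?ptmod_ge0 ?addr_ge0 ?ptmod_ge0//.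
  rewrite sqrrD !sqr_ptmod.
  suff : z.1 * u.1 + z.2 * u.2 <= ptmod z * ptmod u by rewrite /sqN /=; lra.
  rewrite ptmodE ptmodE -sqrtrM ?sqN_ge0//; apply: le_trans (ler_norm _) _.
  rewrite -sqrtr_sqr ler_sqrt ?mulr_ge0 ?sqN_ge0//.
  have := sqr_ge0 (z.1 * u.2 - z.2 * u.1); rewrite /sqN; lra.
rewrite ler_wpM2r ?(ltW (v_gt0 _))//.
have e1 := expR_ge1Dx (ptmod z).
rewrite -powR_mulrn ?addr_ge0// -powRrM.
apply: le_trans (_ : expR (ptmod z) `^ (2 * s) <= _); last first.
  by rewrite -expRM [ptmod z * _]mulrC.
by rewrite ge0_ler_powR ?mulr_ge0// ?nnegrE ?expR_ge0 ?addr_ge0.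
Qed.

End harnack.

(** * The first estimate, term by term *)

Lemma ler_powRN (R : realType) (s x y : R) : 0 <= s -> 0 < x -> x <= y ->
  y `^ (- s) <= x `^ (- s).
Proof.
move=> s0 x0 xy; have y0 := lt_le_trans x0 xy.
by rewrite !powRN lef_pV2 ?posrE ?powR_gt0// ge0_ler_powR// nnegrE ltW.
Qed.

Section tail_bound.
Variable R : realType.
Local Notation C := (R * R)%type.
Implicit Types (z w b : C).

(** Only the cross term 2 Im z Im b can be negative, and it is at least -|b|. Then p^2 - p is
    increasing in p = |b| > [Rr]. *)
Lemma sqN_shift_ge (Rr : R) z b : 2 < Rr -> 0 <= z.1 -> `|z.2| <= 2^-1 -> I1 b -> Rr < ptmod b ->
  Rr ^+ 2 - Rr <= sqN (ptadd z b).
Proof.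
move=> R_gt2 z1 z2 Ib Rb; have b1 := I1_re Ib.
have b2 : `|b.2| <= ptmod b.
  rewrite -ler_sqr ?nnegrE ?ptmod_ge0// sqr_ptmod real_normK ?num_real//.
  by rewrite /sqN lerDr sqr_ge0.
have zb : - (`|z.2| * `|b.2|) <= z.2 * b.2.
  by rewrite -normrM lerNl; apply: le_trans (ler_norm _) _; rewrite normrN.
have pE := sqr_ptmod b.
apply: (@le_trans _ _ (ptmod b ^+ 2 - ptmod b)).
  have : 0 <= (ptmod b - Rr) * (ptmod b + Rr - 1).
    by apply: mulr_ge0; lra.
  lra.
apply: (@le_trans _ _ (sqN b - `|b.2|)); first by rewrite pE; lra.
have := normr_ge0 b.2; have := normr_ge0 z.2; rewrite /sqN /ptadd /=.
have := sqr_ge0 z.1; have := sqr_ge0 z.2; nra.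
Qed.

(** On the box |z|^2 <= 1 + 1/4, hence |z + b|^2 <= |b|^2 + sqrt 5 |b| + 5/4. Dividing by |b|^2 and
    using |b| > [Rr] gives the constant. *)
Lemma sqN_shift_le (Rr : R) z b : 2 < Rr -> 0 <= z.1 <= 1 -> `|z.2| <= 2^-1 -> Rr < ptmod b ->
  sqN (ptadd z b) <= sqN b / (Rr / (Rr + Num.sqrt 5 + 5 / (4 * Rr))).
Proof.
move=> R_gt2 /andP[z0 z1] z2 Rb; set q := Num.sqrt 5.
have q0 : 0 <= q by exact: sqrtr_ge0.
have q5 : q ^+ 2 = 5 by rewrite sqr_sqrtr.
have R0 : 0 < Rr by lra.
have z22 : z.2 ^+ 2 <= 4^-1.
  have := ler_pM (normr_ge0 _) (normr_ge0 _) z2 z2.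
  by rewrite -expr2 real_normK ?num_real//; lra.
have Nz : sqN z <= 5 / 4 by have := ler_pM z0 z0 z1 z1; rewrite -expr2 /sqN; lra.
have zb : 2 * (z.1 * b.1 + z.2 * b.2) <= q * ptmod b.
  rewrite -(ger0_norm (mulr_ge0 q0 (ptmod_ge0 b))); apply: le_trans (ler_norm _) _.
  rewrite -ler_sqr ?nnegrE// !real_normK ?num_real// !exprMn q5 sqr_ptmod.
  have := sqr_ge0 (z.1 * b.2 - z.2 * b.1); have := sqN_ge0 b.
  by move: Nz; rewrite /sqN; nra.
have pb : 0 < ptmod b by lra.
rewrite -(sqr_ptmod b) invf_div.
have -> : ptmod b ^+ 2 * ((Rr + q + 5 / (4 * Rr)) / Rr) =
  ptmod b ^+ 2 + q * ptmod b * (ptmod b / Rr) + 5 / 4 * (ptmod b / Rr) ^+ 2.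
  by field; rewrite gt_eqF.
have r1 : 1 <= ptmod b / Rr by rewrite ler_pdivlMr// mul1r ltW.
have r2 : 1 <= (ptmod b / Rr) ^+ 2 by rewrite expr_ge1//; lra.
have : q * ptmod b <= q * ptmod b * (ptmod b / Rr).
  by rewrite ler_peMr// mulr_ge0// ltW.
by rewrite !sqr_ptmod; move: Nz zb r2; rewrite /sqN /ptadd /=; lra.
Qed.

Variables (U B : set C) (s : R) (v : C -> R) (Rr : R).
Hypotheses (R_gt2 : 2 < Rr) (BI : B `<=` @I1 R) (B0 : B !=set0) (s0 : 0 <= s).
Hypotheses (DU : @Ddisc R `<=` closure U) (v_eig : pos_eigenfunction U B s v).

Lemma eigenfunction_term_ge z b : 0 <= z.1 <= 1 -> `|z.2| <= 2^-1 -> B b ->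
  Rr < ptmod b ->
  CRs Rr s * v (0, 0) * ptmod b `^ (- (2 * s)) <=
  ptmod (ptadd z b) `^ (- (2 * s)) * v (theta b z).
Proof.
move=> z1 z2 Bb Rb; have R2 := R_gt2; have Ib := BI Bb; have b1 := I1_re Ib.
have z0 : 0 <= z.1 by case/andP: z1.
have zb1 : 1 <= (ptadd z b).1 by rewrite /=; lra.
have lo := sqN_shift_ge R_gt2 z0 z2 Ib Rb; have hi := sqN_shift_le R_gt2 z1 z2 Rb.
have RR : 0 < Rr ^+ 2 - Rr by nra.
rewrite !ptmod_powR /CRs.
have k0 : 0 < Rr / (Rr + Num.sqrt 5 + 5 / (4 * Rr)).
  by rewrite divr_gt0 ?addr_gt0 ?divr_gt0 ?mulr_gt0 ?sqrtr_gt0//; lra.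
have H0 := harnack0 BI B0 s0 DU v_eig (theta_disc Ib z0).
have v0 : 0 <= v (theta b z).
  by apply/ltW; case: v_eig => _ [+ _]; apply; exact/DU/theta_disc.
have Nb : 0 < sqN b by rewrite sqN_gt0.
have Nzb : 0 < sqN (ptadd z b) by rewrite sqN_gt0.
(* The exponent in [harnack0] is 2s |theta_b z|, where |theta_b z| = 1/|z + b| <= 1/sqrt(Rr^2 - Rr);
   the factor 2 is relaxed to sqrt 5. *)
have E : expR (- (Num.sqrt 5 * s) / Num.sqrt (Rr ^+ 2 - Rr)) * v (0, 0) <= v (theta b z).
  apply: le_trans (_ : expR (- (Num.sqrt 5 * s) / Num.sqrt (Rr ^+ 2 - Rr)) *
    (expR (2 * s * ptmod (theta b z)) * v (theta b z)) <= _).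
    by rewrite ler_wpM2l ?expR_ge0.
  rewrite mulrA -expRD ler_piMl// -[leRHS]expR0 ler_expR mulNr addrC subr_le0.
  rewrite ptmodE sqN_ptinv// sqrtrV ?sqN_ge0//.
  apply: ler_pM; rewrite ?mulr_ge0 ?invr_ge0 ?sqrtr_ge0//.
  - rewrite ler_wpM2r// -ler_sqr ?nnegrE ?sqrtr_ge0// sqr_sqrtr//; lra.
  - by rewrite lef_pV2 ?posrE ?sqrtr_gt0// ler_sqrt// ltW.
have F : (Rr / (Rr + Num.sqrt 5 + 5 / (4 * Rr))) `^ s * sqN b `^ (- s) <=
    sqN (ptadd z b) `^ (- s).
  apply: le_trans (ler_powRN s0 Nzb hi); move: (Rr / _) k0 => k k0.
  rewrite (powRM _ (ltW Nb)) ?invr_ge0 ?(ltW k0)// -powR_inv1 ?(ltW k0)// -powRrM mulN1r opprK.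
  by rewrite mulrC.
apply: le_trans (ler_pM _ _ F E); rewrite ?mulr_ge0 ?powR_ge0 ?expR_ge0//.
  by rewrite le_eqVlt; apply/orP; left; apply/eqP; ring.
by apply/ltW; case: v_eig => _ [+ _]; apply; apply/DU/DdiscE; rewrite /sqN /= expr0n/= addr0.
Qed.

Lemma eigenfunction_tail_ge z : 0 <= z.1 <= 1 -> `|z.2| <= 2^-1 ->
  ((CRs Rr s * v (0, 0))%:E *
     (\esum_(b in B `&` [set b | (Rr < ptmod b)%R]) (ptmod b `^ (- (2 * s)))%:E)
   <= \esum_(b in B `&` [set b | (Rr < ptmod b)%R])
        (ptmod (ptadd z b) `^ (- (2 * s)) * v (theta b z))%:E)%E.
Proof.
move=> z1 z2; have R2 := R_gt2.
have c0 : 0 < CRs Rr s * v (0, 0).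
  rewrite mulr_gt0//; last first.
    case: v_eig => _ [+ _]; apply; apply/DU/DdiscE.
    by rewrite /sqN /= expr0n/= addr0.
  rewrite mulr_gt0 ?expR_gt0// powR_gt0// divr_gt0 ?addr_gt0 ?divr_gt0 ?mulr_gt0 ?sqrtr_gt0//; lra.
have t0 b : B b -> 0 <= ptmod (ptadd z b) `^ (- (2 * s)) * v (theta b z).
  move=> Bb; rewrite mulr_ge0 ?powR_ge0// ltW//.
  case: v_eig => _ [+ _]; apply; apply/DU/theta_disc; first exact: BI.
  by case/andP: z1.
rewrite -lee_pdivlMl//; apply: le_esumZ => [|b [Bb _]|b [Bb /= Rb]].
- by rewrite invr_ge0 ltW.
- by rewrite lee_fin t0.
by rewrite -EFinM lee_fin ler_pdivlMl// eigenfunction_term_ge.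
Qed.

End tail_bound.

(** * The area integral over a sector outside a disc *)

Section sector_integral.
Variable R : realType.
Local Notation mu := (@lebesgue_measure R).

Lemma cvg_powRN_infty (q : R) : 0 < q -> x `^ (- q) @[x --> +oo] --> 0.
Proof.
move=> q0; apply/cvgrPdist_le => e e0.
near=> x.
have x0 : 0 < x by near: x; apply: nbhs_pinfty_gt; rewrite num_real.
rewrite sub0r normrN ger0_norm ?powR_ge0//.
have -> : e = (e `^ (- q^-1)) `^ (- q).
  by rewrite -powRrM mulrNN mulVf ?gt_eqF// powRr1// ltW.
apply: ler_powRN; [exact: ltW|exact: powR_gt0|].
by near: x; apply: nbhs_pinfty_ge; rewrite num_real.
Unshelve. all: by end_near. Qed.

Lemma integral_powRN (p a : R) : 1 < p -> 0 < a ->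
  (\int[mu]_(x in `[a, +oo[) (x `^ (- p))%:E = (a `^ (1 - p) / (p - 1))%:E)%E.
Proof.
move=> p1 a0; pose F x : R := - (p - 1)^-1 * x `^ (1 - p).
have dF (x : R) : 0 < x -> is_derive x 1 F (x `^ (- p)).
  move=> x0; have := is_derive1_powR (1 - p) x0.
  move=> /(is_deriveZ (- (p - 1)^-1)).
  rewrite /GRing.scale/= => h; apply: is_derive_eq h _.
  have -> : 1 - p - 1 = - p by ring.
  by field; rewrite gt_eqF// subr_gt0.
have cF (x : R) : 0 < x -> {for x, continuous F}.
  move=> x0; apply: differentiable_continuous.
  by apply/derivable1_diffP; have [] := dF x x0.
rewrite (@ge0_continuous_FTC2y _ _ F _ 0).
- by rewrite -EFinB /F; congr (_%:E); field; rewrite gt_eqF// subr_gt0.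
- by move=> x _; exact: powR_ge0.
- apply: continuous_in_subspaceT => x /set_mem /=; rewrite in_itv/= andbT => ax.
  apply: differentiable_continuous; apply/derivable1_diffP/derivable_powR.
  by rewrite in_itv/= andbT (lt_le_trans a0).
- have -> : 0 = - (p - 1)^-1 * 0 :> R by rewrite mulr0.
  apply: cvgM; first exact: cvg_cst.
  by rewrite -opprB; apply: cvg_powRN_infty; rewrite subr_gt0.
- by move=> x ax; have [] := dF x (lt_trans a0 ax).
- by apply: cvg_at_right_filter; exact: cF.
- move=> x; rewrite in_itv/= andbT => ax; have x0 := lt_trans a0 ax.
  by rewrite derive1E; have dFx := dF x x0; rewrite derive_val.
Qed.

(** With t = y/x the area element is x dx dt, |z|^2 = x^2 (1 + t^2), and |z| >= rho becomes the
    lower limit in x. The remaining factor 1/(1 + t^2) is the derivative of arctan. *)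
Lemma integral_ray (s rho t : R) : 1 < s -> 0 < rho ->
  (\int[mu]_(x in `[(rho / Num.sqrt (1 + t ^+ 2))%R, +oo[)
     (x * (x ^+ 2 + (x * t) ^+ 2) `^ (- s))%:E =
   (rho `^ (2 - 2 * s) / (2 * s - 2) * (1 + t ^+ 2)^-1)%:E)%E.
Proof.
move=> s1 r0; set c := 1 + t ^+ 2.
have c0 : 0 < c by rewrite ltr_pwDl// sqr_ge0.
have a0 : 0 < rho / Num.sqrt c by rewrite divr_gt0 ?sqrtr_gt0.
transitivity (\int[mu]_(x in `[(rho / Num.sqrt c)%R, +oo[)
    ((c `^ (- s))%:E * (x `^ (- (2 * s - 1)))%:E))%E.
  apply: eq_integral => x /set_mem /=; rewrite in_itv/= andbT => ax.
  have x0 := lt_le_trans a0 ax.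
  rewrite -EFinM; congr (_%:E).
  have -> : x ^+ 2 + (x * t) ^+ 2 = x ^+ 2 * c by rewrite /c; ring.
  rewrite powRM ?sqr_ge0// ?(ltW c0)// -powR_mulrn ?(ltW x0)// -powRrM mulrA.
  rewrite -{1}[x]powRr1 ?(ltW x0)// -powRD; last by rewrite (gt_eqF x0) implybT.
  by rewrite mulrC; congr (_ * _ `^ _); ring.
have -> : (\int[mu]_(x in `[(rho / Num.sqrt c)%R, +oo[)
      ((c `^ (- s))%:E * (x `^ (- (2 * s - 1)))%:E) =
    (c `^ (- s))%:E * \int[mu]_(x in `[(rho / Num.sqrt c)%R, +oo[)
      (x `^ (- (2 * s - 1)))%:E)%E.
  apply: ge0_integralZl_EFin => //; first by move=> x _; rewrite lee_fin powR_ge0.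
  by apply/measurable_EFinP; apply: measurable_funTS; exact: measurable_powR.
  exact: powR_ge0.
rewrite integral_powRN//; last by lra.
rewrite -EFinM; congr (_%:E).
have -> : 1 - (2 * s - 1) = 2 - 2 * s by ring.
have -> : 2 * s - 1 - 1 = 2 * s - 2 by ring.
have sE : (Num.sqrt c)^-1 `^ (2 - 2 * s) = c `^ (s - 1).
  rewrite -powR12_sqrt ?(ltW c0)// -[(c `^ _)^-1]powR_inv1 ?powR_ge0// -!powRrM.
  by congr (_ `^ _); field.
have cE : c^-1 = c `^ (- s) * c `^ (s - 1).
  rewrite -powRD; last by rewrite (gt_eqF c0) implybT.
  by rewrite addrA addNr sub0r powR_inv1// ltW.
by rewrite powRM ?invr_ge0 ?sqrtr_ge0 ?(ltW r0)// sE cE; ring.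
Qed.

Lemma integral_sector (s rho T0 T1 : R) : 1 < s -> 0 < rho -> T0 < T1 ->
  (\int[mu]_(t in `[T0, T1])
    \int[mu]_(x in `[(rho / Num.sqrt (1 + t ^+ 2))%R, +oo[)
      (x * (x ^+ 2 + (x * t) ^+ 2) `^ (- s))%:E =
   (rho `^ (2 - 2 * s) / (2 * s - 2) * (atan T1 - atan T0))%:E)%E.
Proof.
move=> s1 r0 T01; set J := rho `^ (2 - 2 * s) / (2 * s - 2).
under eq_integral do rewrite integral_ray//.
rewrite -/J (@continuous_FTC2 _ _ (fun t => J * atan t))//.
- by rewrite -EFinB mulrBr.
- apply: continuous_subspaceT => t; apply: cvgM; first exact: cvg_cst.
  apply: cvgV; first by rewrite gt_eqF// ltr_pwDl// sqr_ge0.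
  by apply: cvgD; [exact: cvg_cst|apply: cvgM; exact: cvg_id].
- have cA t : {for t, continuous (fun t : R => J * atan t)}.
    by apply: cvgM; [exact: cvg_cst|exact: continuous_atan].
  split; [move=> t _|apply: cvg_at_right_filter; exact: cA|
    apply: cvg_at_left_filter; exact: cA].
  exact: derivableZ.
- move=> t _; rewrite derive1E deriveZ//= -derive1E derive1_atan.
  by rewrite /GRing.scale.
Qed.

End sector_integral.

(** * Affine densities on the unit cells *)

Section cells.
Variable R : realType.
Local Notation mu := (@lebesgue_measure R).
Local Notation mR := (measurableTypeR R).

Lemma integral_affine (al be l r : R) : l < r ->
  (\int[mu]_(x in `[l, r[) (al + be * x)%:E =
   (al * (r - l) + be * ((r ^+ 2 - l ^+ 2) / 2))%:E)%E.
Proof.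
move=> lr.
have m1 (D : set R) : measurable_fun D (fun x : R => (al + be * x)%:E).
  apply/measurable_EFinP/measurable_funD; first exact: measurable_cst.
  by apply: measurable_funM; [exact: measurable_cst|exact: measurable_id].
have c1 (a b x : R) : {for x, continuous (fun x : R => a + b * x)}.
  by apply: cvgD; [exact: cvg_cst|apply: cvgM; [exact: cvg_cst|exact: cvg_id]].
rewrite integral_itv_bndo_bndc//.
pose F x := al * x + be / 2 * (x * x).
have dF (x : R) : is_derive x 1 F (al + be * x).
  by rewrite /F; apply: is_derive_eq; rewrite /GRing.scale/=; field.
have cF (x : R) : {for x, continuous F}.
  by apply: differentiable_continuous; apply/derivable1_diffP; have [] := dF x.
rewrite (@continuous_FTC2 _ _ F)//.
- by rewrite -EFinB /F; congr (_%:E); field.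
- by apply: continuous_subspaceT => x; exact: c1.
- split; [by move=> x _; have [] := dF x|apply: cvg_at_right_filter; exact: cF|
    apply: cvg_at_left_filter; exact: cF].
- by move=> x _; rewrite derive1E; have dFx := dF x; rewrite derive_val.
Qed.

(** In the coordinates (x, t = y/x), this is the affine weight a + b (x - m) + c (y - n) on the
    cell, multiplied by the Jacobian x and extended by 0. Cells are half-open so that they tile the
    quadrant. *)
Definition cell_fun (m n : nat) (a b c : R) (z : mR * mR) : \bar R :=
  if [&& m%:R <= z.1, z.1 < m.+1%:R, n%:R <= z.1 * z.2 & z.1 * z.2 < n.+1%:R]
  then (z.1 * (a + b * (z.1 - m%:R) + c * (z.1 * z.2 - n%:R)))%:E else 0%E.

Lemma measurable_cell_fun m n a b c : measurable_fun setT (cell_fun m n a b c).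
Proof.
have m1 : measurable_fun setT (fun z : mR * mR => z.1 : mR) by exact: measurable_fst.
have m2 : measurable_fun setT (fun z : mR * mR => z.2 : mR) by exact: measurable_snd.
have m12 : measurable_fun setT (fun z : mR * mR => z.1 * z.2 : mR).
  exact: measurable_funM.
apply: measurable_fun_ifT; last exact: measurable_cst.
  by do ! apply: measurable_and; (apply: measurable_fun_ler || apply: measurable_fun_ltr).
apply/measurable_EFinP/measurable_funM => //.
by do ! apply: measurable_funD => //; apply: measurable_funM => //;
  apply: measurable_funB.
Qed.

(** In the coordinates (x, y) this is the mean of an affine function over a unit square, its value
    at the centre. *)
Lemma integral_cell_fun (m n : nat) a b c : (0 < m)%N ->
  (forall u t, 0 <= u < 1 -> 0 <= t < 1 -> 0 <= a + b * u + c * t) ->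
  (\int[mu \x mu]_z cell_fun m n a b c z = (a + b / 2 + c / 2)%:E)%E.
Proof.
move=> m0 w0.
have f0 z : (0 <= cell_fun m n a b c z)%E.
  rewrite /cell_fun; case: ifPn => // /and4P[h1 h2 h3 h4]; rewrite lee_fin mulr_ge0//.
    by apply: le_trans h1.
  by apply: w0; rewrite subr_ge0 ltrBlDr -natr1 addrC in h1 h2 h3 h4 *; apply/andP; split; lra.
rewrite fubini_tonelli1//; last exact: measurable_cell_fun.
transitivity (\int[mu]_(x in `[m%:R, m.+1%:R[) (a + c / 2 - b * m%:R + b * x)%:E)%E.
  rewrite [RHS]integral_mkcond; apply: eq_integral => x _; rewrite /fubini_F patchE.
  case: ifPn => [/set_mem /=|]; last first.
    move=> xm; rewrite integral0_eq// => t _; rewrite /cell_fun /=.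
    case: ifPn => // /and4P[h1 h2 _ _].
    by move: xm; rewrite notin_setE /= in_itv/= h1 h2.
  rewrite in_itv/= => /andP[mx xm1].
  have x0 : 0 < x by apply: lt_le_trans mx; rewrite ltr0n.
  (* For fixed x the row is an interval in t of length 1/x, which cancels the Jacobian. *)
  transitivity (\int[mu]_(t in `[(n%:R / x)%R, (n.+1%:R / x)%R[)
      ((x * (a + b * (x - m%:R) - c * n%:R)) + x * x * c * t)%:E)%E.
    rewrite [RHS]integral_mkcond; apply: eq_integral => t _; rewrite patchE.
    rewrite /cell_fun/= mx xm1 /= -ler_pdivrMl// -ltr_pdivlMl// ![x^-1 * _]mulrC.
    have -> : (n%:R / x <= t) && (t < n.+1%:R / x) = (t \in `[(n%:R / x), (n.+1%:R / x)[%classic).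
      by rewrite mem_setE in_itv.
    by case: ifPn => // _; congr (_%:E); ring.
  rewrite integral_affine; last by rewrite ltr_pM2r ?invr_gt0// ltr_nat.
  by rewrite -natr1; congr (_%:E); field; rewrite gt_eqF.
rewrite integral_affine ?ltr_nat//.
by rewrite -natr1; congr (_%:E); field.
Qed.

End cells.

(** * Comparison of the sector integral with sums over cells *)

Section sector_cells.
Variable R : realType.
Local Notation mu := (@lebesgue_measure R).
Local Notation mR := (measurableTypeR R).

Lemma nneseries_term (f : nat -> \bar R) (n : nat) :
  (forall k, (0 <= f k)%E) -> (f n <= \sum_(k <oo) f k)%E.
Proof.
move=> f0; rewrite (nneseriesD1 _ (n := n))// leeDl//.
by apply: nneseries_ge0 => k _ _; exact: f0.
Qed.

(** Every point of the sector lies in the cell given by its integer parts, where the weight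
    dominates |z|^(-2s). So the density is bounded pointwise by the sum of the cell functions, which
    is then integrated term by term. *)
Lemma sector_le_cells (s rho T0 T1 : R) (a b c : nat -> nat -> R) :
  1 < s -> 0 <= T0 < T1 -> Num.sqrt (1 + T1 ^+ 2) <= rho ->
  (forall m n u t, 0 <= u < 1 -> 0 <= t < 1 ->
    0 <= a m n + b m n * u + c m n * t) ->
  (forall m n (u t : R), (0 < m)%N -> 0 <= u < 1 -> 0 <= t < 1 ->
    rho ^+ 2 <= (m%:R + u) ^+ 2 + (n%:R + t) ^+ 2 ->
    T0 * (m%:R + u) <= n%:R + t ->
    ((m%:R + u) ^+ 2 + (n%:R + t) ^+ 2) `^ (- s) <= a m n + b m n * u + c m n * t) ->
  ((rho `^ (2 - 2 * s) / (2 * s - 2) * (atan T1 - atan T0))%:E <=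
   \sum_(m <oo) \sum_(n <oo) (a m.+1 n + b m.+1 n / 2 + c m.+1 n / 2)%:E)%E.
Proof.
move=> s1 /andP[T00 T01] rhoT w0 Hw.
have sT : 0 < Num.sqrt (1 + T1 ^+ 2) by rewrite sqrtr_gt0 ltr_pwDl// sqr_ge0.
have r0 : 0 < rho by exact: lt_le_trans rhoT.
pose rad t := rho / Num.sqrt (1 + t ^+ 2).
pose G (z : mR * mR) : \bar R :=
  if [&& T0 <= z.2, z.2 <= T1 & rad z.2 <= z.1]
  then (z.1 * (z.1 ^+ 2 + (z.1 * z.2) ^+ 2) `^ (- s))%:E else 0%E.
pose f m n := @cell_fun R m.+1 n (a m.+1 n) (b m.+1 n) (c m.+1 n).
have c0 (t : R) : 0 < 1 + t ^+ 2 by rewrite ltr_pwDl// sqr_ge0.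
have rad0 t : 0 < rad t by rewrite divr_gt0 ?sqrtr_gt0.
have G0 z : (0 <= G z)%E.
  rewrite /G; case: ifPn => // /and3P[_ _ h]; rewrite lee_fin mulr_ge0 ?powR_ge0//.
  by apply: le_trans h; exact: ltW.
have f0 m n z : (0 <= f m n z)%E.
  rewrite /f /cell_fun; case: ifPn => // /and4P[h1 h2 h3 h4]; rewrite lee_fin mulr_ge0//.
    by apply: le_trans h1.
  by apply: w0; rewrite subr_ge0 ltrBlDr -natr1 addrC in h1 h2 h3 h4 *; apply/andP; split; lra.
have mf m n : measurable_fun setT (f m n) by exact: measurable_cell_fun.
have m1 : measurable_fun setT (fun z : mR * mR => z.1 : mR) by exact: measurable_fst.
have m2 : measurable_fun setT (fun z : mR * mR => z.2 : mR) by exact: measurable_snd.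
have mG : measurable_fun setT G.
  have msq (g : mR * mR -> mR) : measurable_fun setT g ->
      measurable_fun setT (fun z => g z ^+ 2 : mR).
    by move=> mg; under eq_fun do rewrite expr2; exact: measurable_funM.
  have mpow (g : mR * mR -> mR) (p : R) : measurable_fun setT g ->
      measurable_fun setT (fun z => g z `^ p : mR).
    by move=> mg; apply: (measurableT_comp (measurable_powR p)).
  apply: measurable_fun_ifT; last exact: measurable_cst.
    do ! apply: measurable_and; apply: measurable_fun_ler => //.
    rewrite (_ : (fun _ => _) =
      (fun z : mR * mR => rho * ((1 + z.2 ^+ 2) `^ 2^-1) `^ (-1))).
      apply: measurable_funM => //; apply: (mpow); apply: (mpow).
      by apply: measurable_funD => //; exact: msq.
    by apply/funext => z; rewrite /rad powR12_sqrt ?(ltW (c0 _))// powR_inv1 ?sqrtr_ge0.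
  apply/measurable_EFinP/measurable_funM => //; apply: (mpow).
  by apply: measurable_funD; apply: (msq) => //; exact: measurable_funM.
have GI : (\int[mu \x mu]_z G z =
    (rho `^ (2 - 2 * s) / (2 * s - 2) * (atan T1 - atan T0))%:E)%E.
  (* The sector is integrated along its rays, x first, whereas the cells were integrated in t
     first. *)
  rewrite fubini_tonelli2// -integral_sector// [RHS]integral_mkcond.
  apply: eq_integral => t _; rewrite /fubini_G patchE /G /=.
  case: ifPn => [/set_mem /=|]; last first.
    rewrite notin_setE /= in_itv/= => /negP tT; apply: integral0_eq => x _.
    by rewrite andbA (negbTE tT).
  rewrite in_itv/= => /andP[t0 t1]; rewrite [RHS]integral_mkcond.
  apply: eq_integral => x _; rewrite t0 t1 patchE /=.
  by rewrite mem_setE in_itv/= andbT.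
rewrite -GI.
apply: (@le_trans _ _ (\int[mu \x mu]_z \sum_(m <oo) \sum_(n <oo) f m n z)%E).
  apply: ge0_le_integral => //.
  - apply: ge0_emeasurable_sum => // [m z _ _|m _]; first exact: nneseries_ge0.
    by apply: ge0_emeasurable_sum.
  move=> [x t] _; rewrite {1}/G /=; case: ifPn => [/and3P[t0 t1 xr]|_]; last first.
    by do 2 (apply: nneseries_ge0 => ? _ _).
  have rx : rho ^+ 2 <= x ^+ 2 + (x * t) ^+ 2.
    have -> : x ^+ 2 + (x * t) ^+ 2 = (x * Num.sqrt (1 + t ^+ 2)) ^+ 2.
      by rewrite [RHS]exprMn sqr_sqrtr ?(ltW (c0 _))//; ring.
    rewrite ler_sqr ?nnegrE ?(ltW r0)//; first by rewrite -ler_pdivrMr ?sqrtr_gt0.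
    by rewrite mulr_ge0 ?sqrtr_ge0// (le_trans _ xr)// ltW.
  (* The condition sqrt(1 + T1^2) <= rho keeps the sector in x >= 1, so only columns with m >= 1
     occur. *)
  have x1 : 1 <= x.
    apply: le_trans xr; rewrite ler_pdivlMr ?sqrtr_gt0// mul1r; apply: le_trans rhoT.
    by rewrite ler_sqrt ?(ltW (c0 _))// lerD2l ler_sqr ?nnegrE// (le_trans T00)// (le_trans t0).
  have t00 : 0 <= t by exact: le_trans t0.
  have xt0 : 0 <= x * t by rewrite mulr_ge0//; lra.
  have /andP[mx xm] := truncn_itv (le_trans ler01 x1).
  have /andP[ny yn] := truncn_itv xt0.
  have : (0 < Num.truncn x)%N by rewrite truncn_gt0.
  move: (Num.truncn x) (Num.truncn (x * t)) mx xm ny yn => [//|m] n mx xm ny yn _.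
  apply: (@le_trans _ _ (f m n (x, t))); last first.
    apply: le_trans (nneseries_term m _); last by move=> k; exact: nneseries_ge0.
    exact: nneseries_term.
  rewrite /f /cell_fun /= mx xm ny yn /= lee_fin ler_wpM2l//; first by lra.
  have := Hw m.+1 n (x - m.+1%:R) (x * t - n%:R) isT.
  rewrite ![_%:R + (_ - _)]addrC !subrK; apply => //.
  - by rewrite subr_ge0 mx ltrBlDr addrC natr1.
  - by rewrite subr_ge0 ny ltrBlDr addrC natr1.
  - by rewrite mulrC ler_wpM2l//; lra.
rewrite integral_nneseries//; last 2 first.
- by move=> m; apply: ge0_emeasurable_sum.
- by move=> m z _; exact: nneseries_ge0.
apply: lee_nneseries => [m _ _|m _].
  by apply: integral_ge0 => z _; exact: nneseries_ge0.
rewrite integral_nneseries//.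
apply: lee_nneseries => [n _ _|n _]; first exact: integral_ge0.
by rewrite integral_cell_fun // => u t; exact: w0.
Qed.

End sector_cells.

(** * Pointwise bounds for |z|^(-2s) on a cell *)

Section cell_estimates.
Variable R : realType.
Implicit Types (s l N : R) (m n : nat).

(* Convexity of [x ^ s] reduces the chord inequality for [N ^ (-s)] to the one for [1 / N]. *)
Lemma powRN_chord s l N0 N1 N : 1 <= s -> 0 <= l <= 1 ->
  0 < N0 -> 0 < N1 -> 0 < N -> N0 * N1 <= N * ((1 - l) * N1 + l * N0) ->
  N `^ (- s) <= (1 - l) * N0 `^ (- s) + l * N1 `^ (- s).
Proof.
move=> s1 /andP[l0 l1] N00 N10 N_0 H.
have V (x : R) : 0 < x -> x `^ (- s) = (x^-1) `^ s.
  by move=> x0; rewrite -powR_inv1 ?(ltW x0)// -powRrM mulN1r.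
rewrite !V//.
apply: (@le_trans _ _ (((1 - l) * N0^-1 + l * N1^-1) `^ s)).
  rewrite ge0_ler_powR ?nnegrE ?invr_ge0 ?(ltW N_0)//; first by lra.
    by rewrite addr_ge0// mulr_ge0 ?invr_ge0 ?subr_ge0// ltW.
  have -> : (1 - l) * N0^-1 + l * N1^-1 = ((1 - l) * N1 + l * N0) / (N0 * N1).
    by field; rewrite !gt_eqF.
  by rewrite ler_pdivlMr ?mulr_gt0// ler_pdivrMl// mulrC [leRHS]mulrC.
have := @convex_powR R s s1 (Itv01 l0 l1) N1^-1 N0^-1.
rewrite !inE /= !in_itv /= !invr_ge0 !(ltW N00) !(ltW N10) => /(_ isT isT).
by rewrite addrC [leRHS]addrC.
Qed.

Definition latN m n : R := m%:R ^+ 2 + n%:R ^+ 2.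

Lemma latN_gt0 m n : (0 < m)%N -> 0 < latN m n.
Proof. by move=> m0; rewrite ltr_pwDl ?sqr_ge0// exprn_gt0// ltr0n. Qed.

Lemma latNS m n : latN m n.+1 = latN m n + (2 * n%:R + 1).
Proof. by rewrite /latN -natr1; ring. Qed.

Lemma cell_bound_floor s m n (u t : R) : 0 <= s -> (0 < m)%N -> 0 <= u -> 0 <= t ->
  ((m%:R + u) ^+ 2 + (n%:R + t) ^+ 2) `^ (- s) <= latN m n `^ (- s).
Proof.
move=> s0 m0 u0 t0; apply: ler_powRN => //; first exact: latN_gt0.
by rewrite lerD// ler_sqr ?nnegrE ?addr_ge0// lerDl.
Qed.

(** Since 2m >= 2n + 1, |z|^2 is at least the linear interpolation, with parameter u, of its values
    N0 at (m, n) and N0 + S at (m, n + 1), S = 2n + 1. The chord condition holds because (N0 +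
    uS)(N0 + (1 - u)S) exceeds N0 (N0 + S) by u(1 - u)S^2. *)
Lemma cell_bound_below s m n (u t : R) : 1 <= s -> (n < m)%N -> 0 <= u <= 1 -> 0 <= t ->
  ((m%:R + u) ^+ 2 + (n%:R + t) ^+ 2) `^ (- s) <=
  (1 - u) * latN m n `^ (- s) + u * latN m n.+1 `^ (- s).
Proof.
move=> s1 nm /andP[u0 u1] t0; have m0 : (0 < m)%N by case: m nm.
have N0 := latN_gt0 n m0; have N1 := latN_gt0 n.+1 m0.
have mn : n%:R + 1 <= m%:R :> R by rewrite natr1 ler_nat.
have n0 : 0 <= n%:R :> R by [].
have N_ge : latN m n + u * (2 * n%:R + 1) <= (m%:R + u) ^+ 2 + (n%:R + t) ^+ 2.
  have : u * (2 * n%:R + 1) <= u * (2 * m%:R) by rewrite ler_wpM2l//; lra.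
  have := mulr_ge0 n0 t0; have := sqr_ge0 u; have := sqr_ge0 t.
  by rewrite /latN; lra.
apply: powRN_chord => //; rewrite ?u0//.
  apply: lt_le_trans N_ge; rewrite ltr_pwDl// mulr_ge0//; lra.
rewrite latNS; move: N0 N_ge; move: (latN m n) (_ ^+ 2 + _) => M N M0 MN.
have -> : (1 - u) * (M + (2 * n%:R + 1)) + u * M = M + (1 - u) * (2 * n%:R + 1) by ring.
have E : 0 <= (1 - u) * (2 * n%:R + 1) by rewrite mulr_ge0//; lra.
apply: (@le_trans _ _ ((M + u * (2 * n%:R + 1)) * (M + (1 - u) * (2 * n%:R + 1)))).
  have : 0 <= u * (1 - u) * (2 * n%:R + 1) ^+ 2 by rewrite !mulr_ge0 ?sqr_ge0//; lra.
  lra.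
by rewrite ler_wpM2r//; lra.
Qed.

(** Now |z|^2 is only bounded below by N0 + t(2n + t), short of the linear interpolation by t(1 -
    t). The loss t(1 - t) N0 in the chord condition is covered by the gain t(1 - t)(2n + t)(2n + 1),
    as N0 = m^2 + n^2 <= 2n^2. *)
Lemma cell_bound_above s m n (u t : R) : 1 <= s -> (0 < m <= n)%N -> 0 <= u -> 0 <= t <= 1 ->
  ((m%:R + u) ^+ 2 + (n%:R + t) ^+ 2) `^ (- s) <=
  (1 - t) * latN m n `^ (- s) + t * latN m n.+1 `^ (- s).
Proof.
move=> s1 /andP[m0 mn] u0 /andP[t0 t1].
have N0 := latN_gt0 n m0; have N1 := latN_gt0 n.+1 m0.
have mn' : m%:R <= n%:R :> R by rewrite ler_nat.
have m0' : 0 <= m%:R :> R by [].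
have n0 : 0 <= n%:R :> R by [].
have N_ge : latN m n + t * (2 * n%:R + t) <= (m%:R + u) ^+ 2 + (n%:R + t) ^+ 2.
  have := mulr_ge0 m0' u0; have := sqr_ge0 u.
  by rewrite /latN; lra.
apply: powRN_chord => //; rewrite ?t0//.
  apply: lt_le_trans N_ge; rewrite ltr_pwDl// mulr_ge0//; lra.
have MS : latN m n <= (2 * n%:R + t) * (2 * n%:R + 1).
  by have := ler_pM m0' m0' mn' mn'; have := mulr_ge0 n0 t0; rewrite /latN; nra.
rewrite latNS; move: N0 N_ge MS; move: (latN m n) (_ ^+ 2 + _) => M N M0 MN MS.
have -> : (1 - t) * (M + (2 * n%:R + 1)) + t * M = M + (1 - t) * (2 * n%:R + 1) by ring.
have E : 0 <= (1 - t) * (2 * n%:R + 1) by rewrite mulr_ge0//; lra.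
apply: (@le_trans _ _ ((M + t * (2 * n%:R + t)) * (M + (1 - t) * (2 * n%:R + 1)))).
  have : 0 <= t * (1 - t) * ((2 * n%:R + t) * (2 * n%:R + 1) - M).
    by rewrite !mulr_ge0//; lra.
  lra.
by rewrite ler_wpM2r//; lra.
Qed.

(** A point of the half-open cell is at distance less than sqrt 2 from the corner (m, n): this is
    the origin of the radius [Rr + Num.sqrt 2]. *)
Lemma cell_tail (Rr : R) m n (u t : R) : 0 <= Rr -> 0 <= u < 1 -> 0 <= t < 1 ->
  (Rr + Num.sqrt 2) ^+ 2 <= (m%:R + u) ^+ 2 + (n%:R + t) ^+ 2 ->
  Rr ^+ 2 < latN m n.
Proof.
move=> R0 /andP[u0 u1] /andP[t0 t1] H; rewrite ltNge; apply/negP => L.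
set q := Num.sqrt 2 in H; have q0 : 0 < q by rewrite sqrtr_gt0.
have q2 : q ^+ 2 = 2 by rewrite sqr_sqrtr.
have u2 : u ^+ 2 + t ^+ 2 < 2.
  have := ler_pM u0 u0 (ltW u1) (ltW u1); have := ler_pM t0 t0 (ltW t1) (ltW t1).
  by rewrite -!expr2; nra.
have mu : m%:R * u + n%:R * t <= Rr * q.
  have m0 : 0 <= m%:R :> R by []. have n0 : 0 <= n%:R :> R by [].
  have Rq : 0 <= Rr * q by rewrite mulr_ge0// ltW.
  rewrite -ler_sqr ?nnegrE ?addr_ge0 ?mulr_ge0 ?(ltW q0)// [leRHS]exprMn q2.
  apply: (@le_trans _ _ (latN m n * (u ^+ 2 + t ^+ 2))).
    by have := sqr_ge0 (m%:R * t - n%:R * u); rewrite /latN; lra.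
  by apply: ler_pM; rewrite ?addr_ge0 ?sqr_ge0// ltW.
move: H L; rewrite sqrrD q2 /latN; lra.
Qed.

End cell_estimates.

(** * Lower bounds for the lattice sums over quadrants *)

Section quadrant_sums.
Variable R : realType.
Implicit Types (s Rr : R) (m n : nat).

Definition tail_term s Rr m n : R :=
  if Rr ^+ 2 < latN R m n then latN R m n `^ (- s) else 0.

Lemma tail_term_ge0 s Rr m n : 0 <= tail_term s Rr m n.
Proof. by rewrite /tail_term; case: ifP => // _; exact: powR_ge0. Qed.

Lemma nneseries_shift (f : nat -> \bar R) : (forall k, (0 <= f k)%E) ->
  (\sum_(k <oo) f k = f 0%N + \sum_(k <oo) f k.+1)%E.
Proof.
move=> f0; rewrite nneseries_recl// -(nneseries_addn 1)//.
by congr (_ + _)%E; apply: eq_eseriesr => k _; rewrite addn1.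
Qed.

(* Columns [m <= Rr] only meet the tail in rows [n >= 1], so there the floor bound is good
   enough. *)
Lemma half_plane_sum s Rr K : 1 < s -> 2 < Rr -> 0 < K ->
  (Rr + Num.sqrt 2) ^+ 2 = 1 + K ^+ 2 ->
  (((Rr + Num.sqrt 2) `^ (2 - 2 * s) / (2 * s - 2) * (2 * atan K))%:E <=
   \sum_(m <oo) \sum_(n <oo) (tail_term s Rr m.+1 n)%:E +
   \sum_(m <oo) \sum_(n <oo) (tail_term s Rr m.+1 n.+1)%:E)%E.
Proof.
move=> s1 R2 K0 KE; set c := tail_term s Rr; set rho := Rr + Num.sqrt 2.
have c0 m n : 0 <= c m n by exact: tail_term_ge0.
have rho0 : 0 < rho by rewrite addr_gt0 ?sqrtr_gt0//; lra.
pose b m n : R := if (Rr < m%:R) && (n < m)%N then c m n.+1 - c m n else 0.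
pose d m n : R := if (Rr < m%:R) && (m <= n)%N then c m n.+1 - c m n else 0.
(* A column with m > [Rr] lies entirely in the tail, so there the chords join true values of the
   power. *)
have cin m n : Rr < m%:R -> c m n = latN R m n `^ (- s).
  move=> Rm; rewrite /c /tail_term ifT// /latN.
  have Rm2 : Rr ^+ 2 < m%:R ^+ 2 by rewrite ltr_sqr ?nnegrE//; lra.
  by have := sqr_ge0 (n%:R : R); lra.
(* The slope [K] is the largest allowed, since sqrt(1 + K^2) = rho. *)
have := @sector_le_cells R s rho 0 K c b d s1.
rewrite lexx K0 atan0 subr0 -KE sqrtr_sqr ger0_norm ?(ltW rho0)// lexx.
move=> /(_ isT isT).
have combo (p q l : R) : 0 <= p -> 0 <= q -> 0 <= l < 1 -> 0 <= p + (q - p) * l.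
  by move=> p0 q0 /andP[l0 l1]; nra.
move=> H; have {}H : ((rho `^ (2 - 2 * s) / (2 * s - 2) * atan K)%:E <=
    \sum_(m <oo) \sum_(n <oo) (c m.+1 n + b m.+1 n / 2 + d m.+1 n / 2)%:E)%E.
  apply: H => [m n u t u01 t01|m n u t m0 u01 t01 rz _].
    rewrite /b /d; case: (ltrP Rr m%:R) => _ /=; last by rewrite !mul0r !addr0.
    by case: ltnP => _; rewrite mul0r addr0; exact: combo.
  have [u0 u1] := andP u01; have [t0 t1] := andP t01.
  rewrite /b /d; case: (ltrP Rr m%:R) => Rm /=; last first.
    rewrite !mul0r !addr0 /c /tail_term ifT; last first.
      by apply: cell_tail u01 t01 rz; lra.
    by apply: cell_bound_floor => //; lra.
  case: ltnP => mn; rewrite mul0r addr0 !cin//.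
  - apply: le_trans (cell_bound_below (ltW s1) mn _ t0) _; first by rewrite u0 ltW.
    by rewrite le_eqVlt; apply/orP; left; apply/eqP; ring.
  - have t01' : 0 <= t <= 1 by rewrite t0 ltW.
    have mn' : (0 < m <= n)%N by rewrite m0.
    apply: le_trans (cell_bound_above (ltW s1) mn' u0 t01') _.
    by rewrite le_eqVlt; apply/orP; left; apply/eqP; ring.
rewrite mulrCA EFinM.
apply: le_trans (lee_wpmul2l _ H) _; first by rewrite lee_fin.
have w0 m n : (0 <= (c m.+1 n + b m.+1 n / 2 + d m.+1 n / 2)%:E)%E.
  have := c0 m.+1 n; have := c0 m.+1 n.+1; rewrite lee_fin /b /d.
  by case: (_ < _) => /=; [case: ltnP => _|]; lra.
rewrite -nneseriesZl; last by move=> m _; exact: nneseries_ge0.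
rewrite -nneseriesD; last 2 first.
- by move=> m _ _; apply: nneseries_ge0 => n _ _; rewrite lee_fin.
- by move=> m _ _; apply: nneseries_ge0 => n _ _; rewrite lee_fin.
apply: lee_nneseries => [m _ _|m _].
  by rewrite mule_ge0 ?lee_fin//; exact: nneseries_ge0.
rewrite -nneseriesZl; last by move=> n _; exact: w0.
case: (ltrP Rr m.+1%:R) => Rm.
  rewrite -nneseriesD; last 2 first.
  - by move=> n _ _; rewrite lee_fin.
  - by move=> n _ _; rewrite lee_fin.
  apply: lee_nneseries => [n _ _|n _]; first by apply: mule_ge0; [rewrite lee_fin|exact: w0].
  (* Twice the mean of the two values is [c m.+1 n + c m.+1 n.+1], one term from each series. *)
  rewrite -EFinM -EFinD lee_fin /b /d Rm /=.
  by case: ltnP => _; lra.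
have cm0 : c m.+1 0%N = 0.
  rewrite /c /tail_term ifF// /latN; apply/negbTE; rewrite -leNgt expr0n addr0.
  by rewrite ler_sqr ?nnegrE//; lra.
have -> : (\sum_(n <oo) (2%:E * (c m.+1 n + b m.+1 n / 2 + d m.+1 n / 2)%:E) =
    \sum_(n <oo) ((c m.+1 n)%:E + (c m.+1 n)%:E))%E.
  apply: eq_eseriesr => n _; rewrite /b /d ltNge Rm /= -EFinM -EFinD.
  by congr (_%:E); ring.
rewrite nneseriesD; last 2 first.
- by move=> n _ _; rewrite lee_fin.
- by move=> n _ _; rewrite lee_fin.
rewrite leeD2l//.
rewrite nneseries_shift; last by move=> n; rewrite lee_fin.
by rewrite cm0 add0e.
Qed.

(** Starting the sector at slope 1/K makes it avoid the row n = 0: if y < 1 and x <= K y, then |z|^2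
    <= (1 + K^2) y^2 < rho^2. *)
Lemma quadrant_sum s Rr K : 1 < s -> 2 < Rr -> 1 < K ->
  (Rr + Num.sqrt 2) ^+ 2 = 1 + K ^+ 2 ->
  (((Rr + Num.sqrt 2) `^ (2 - 2 * s) / (2 * s - 2) * (atan K - atan K^-1))%:E <=
   \sum_(m <oo) \sum_(n <oo) (tail_term s Rr m.+1 n.+1)%:E)%E.
Proof.
move=> s1 R2 K1 KE; set rho := Rr + Num.sqrt 2.
have rho0 : 0 < rho by rewrite addr_gt0 ?sqrtr_gt0//; lra.
have K0 : 0 < K by lra.
pose a m n : R := if n is 0%N then 0 else tail_term s Rr m n.
have a0 m n : 0 <= a m n by case: n => //= n; exact: tail_term_ge0.
have := @sector_le_cells R s rho K^-1 K a (fun _ _ => 0) (fun _ _ => 0) s1.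
have KV1 : K^-1 < 1 by rewrite invf_lt1.
rewrite invr_ge0 (ltW K0) (lt_trans KV1 K1) -KE sqrtr_sqr ger0_norm ?(ltW rho0)// lexx.
move=> /(_ isT isT) H.
apply: le_trans (H _ _) _ => [m n u t _ _|m n u t m0 u01 t01 rz hy|].
- by rewrite !mul0r !addr0.
- have [u0 u1] := andP u01; have [t0 t1] := andP t01.
  rewrite !mul0r !addr0; case: n rz hy => [|n] rz hy /=; last first.
    rewrite /tail_term ifT; last by apply: cell_tail u01 t01 rz; lra.
    by apply: cell_bound_floor => //; lra.
  move: rz hy; rewrite add0r mulrC ler_pdivrMr// KE => rz hy.
  have x0 : 0 <= m%:R + u by rewrite addr_ge0.
  have := ler_pM x0 x0 hy hy; rewrite -!expr2 exprMn => h.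
  have : 1 + K ^+ 2 <= t ^+ 2 * (1 + K ^+ 2) by lra.
  have t2 : t ^+ 2 < 1 by rewrite expr_lt1.
  by have K2 := sqr_ge0 K; nra.
apply: lee_nneseries => [m _ _|m _].
  by apply: nneseries_ge0 => n _ _; rewrite lee_fin !mul0r !addr0.
rewrite nneseries_shift/=; last by move=> n; rewrite lee_fin !mul0r !addr0.
rewrite !mul0r !addr0 add0e le_eqVlt; apply/orP; left; apply/eqP.
by apply: eq_eseriesr => n _; rewrite !addr0.
Qed.

End quadrant_sums.

(** * From double series to sums over I_1 and I_2 *)

Section lattice_sums.
Variable R : realType.
Local Notation C := (R * R)%type.

(** Injectivity prevents double counting, and points outside the range of [e] only add nonnegative
    terms. *)
Lemma double_series_le_esum (T : choiceType) (S : set T) (e : nat -> nat -> T)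
    (a : T -> \bar R) :
  (forall x, (0 <= a x)%E) -> (forall m n, S (e m n)) ->
  injective (fun p : nat * nat => e p.1 p.2) ->
  (\sum_(m <oo) \sum_(n <oo) a (e m n) <= \esum_(x in S) a x)%E.
Proof.
move=> a0 Se e_inj.
rewrite nneseries_esumT; last by move=> m; exact: nneseries_ge0.
have -> : (\esum_(m in [set: nat]) \sum_(n <oo) a (e m n) =
    \esum_(m in [set: nat]) \esum_(n in [set: nat]) a (e m n))%E.
  by apply: eq_esum => m _; rewrite nneseries_esumT.
rewrite (@esum_esum R _ _ setT (fun=> setT) (fun m n => a (e m n)))//.
rewrite -(esum_image _ (fun p : nat * nat => e p.1 p.2) a); last by move=> p q _ _; exact: e_inj.
by apply: le_esum_subset => // x [p _ <-].
Qed.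

Lemma tail_termE s Rr m n (b : C) : 0 <= Rr -> sqN b = latN R m n ->
  (tail_term s Rr m n)%:E = if b \in [set b | Rr < ptmod b]
    then (ptmod b `^ (- (2 * s)))%:E else 0%E.
Proof.
move=> R0 bE; rewrite /tail_term ptmod_powR -bE.
have -> : (b \in [set b | Rr < ptmod b]) = (Rr ^+ 2 < sqN b).
  by rewrite mem_setE /= -sqr_ptmod ltr_sqr ?nnegrE ?ptmod_ge0.
by case: ifP.
Qed.

Let tail_ge0 (s Rr : R) (b : C) : (0 <= if b \in [set b | (Rr < ptmod b)%R]
    then (ptmod b `^ (- (2 * s)))%:E else 0)%E.
Proof. by case: ifP => // _; rewrite lee_fin powR_ge0. Qed.

Lemma quadrant_le_esum_I2 s Rr : 0 <= Rr ->
  (\sum_(m <oo) \sum_(n <oo) (tail_term s Rr m.+1 n.+1)%:E <=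
   \esum_(b in @I2 R `&` [set b | (Rr < ptmod b)%R]) (ptmod b `^ (- (2 * s)))%:E)%E.
Proof.
move=> R0; rewrite esum_mkcondr.
pose e (m n : nat) : C := (m.+1%:R, (- (n.+1%:Z))%:~R).
have -> : (\sum_(m <oo) \sum_(n <oo) (tail_term s Rr m.+1 n.+1)%:E =
    \sum_(m <oo) \sum_(n <oo) (if e m n \in [set b | (Rr < ptmod b)%R]
    then (ptmod (e m n) `^ (- (2 * s)))%:E else 0))%E.
  apply: eq_eseriesr => m _; apply: eq_eseriesr => n _; apply: tail_termE => //.
  by rewrite /sqN /latN /e /= mulrNz sqrrN.
apply: (double_series_le_esum (tail_ge0 s Rr)).
  by move=> m n; exists m.+1, (- (n.+1%:Z)); split.
move=> [m n] [m' n'] /= [/eqP]; rewrite eqr_nat eqSS => /eqP -> /eqP.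
by rewrite eqr_int eqr_opp => /eqP [->].
Qed.

Lemma half_plane_le_esum_I1 s Rr : 0 <= Rr ->
  (\sum_(m <oo) \sum_(n <oo) (tail_term s Rr m.+1 n)%:E +
   \sum_(m <oo) \sum_(n <oo) (tail_term s Rr m.+1 n.+1)%:E <=
   \esum_(b in @I1 R `&` [set b | (Rr < ptmod b)%R]) (ptmod b `^ (- (2 * s)))%:E)%E.
Proof.
(* Splitting by the sign of Im b puts the row n = 0 in the first sum only; the rest contains the I_2
   tail. *)
move=> R0; rewrite (esumID [set b | 0 <= b.2]); last first.
  by move=> b _; rewrite lee_fin powR_ge0.
apply: leeD; last first.
  apply: le_trans (quadrant_le_esum_I2 s R0) _.
  apply: le_esum_subset => [b [Ib Rb]|b _]; last by rewrite lee_fin powR_ge0.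
  split; first by split; [exact: I2_sub_I1|].
  move: Ib => [m [n [_ [n0 ->]]]] /=; apply/negP; rewrite -ltNge.
  by rewrite ltrz0.
rewrite setIAC esum_mkcondr.
pose e (m n : nat) : C := (m.+1%:R, n%:R).
have -> : (\sum_(m <oo) \sum_(n <oo) (tail_term s Rr m.+1 n)%:E =
    \sum_(m <oo) \sum_(n <oo) (if e m n \in [set b | (Rr < ptmod b)%R]
    then (ptmod (e m n) `^ (- (2 * s)))%:E else 0))%E.
  by apply: eq_eseriesr => m _; apply: eq_eseriesr => n _; exact: tail_termE.
apply: (double_series_le_esum (tail_ge0 s Rr)).
  by move=> m n; split; [exists m.+1, n%:Z; split|rewrite /=].
move=> [m n] [m' n'] /= [/eqP]; rewrite eqr_nat eqSS => /eqP -> /eqP.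
by rewrite eqr_nat => /eqP ->.
Qed.

End lattice_sums.

(** * Identification of the angle [thetaR] *)

Section angles.
Variable R : realType.
Implicit Types rho K : R.

(** Both sides are the angle opposite the side 1 in the right triangle with legs 1, K and hypotenuse
    rho. *)
Lemma atan_inv_asin rho K : 0 < K -> 0 < rho -> rho ^+ 2 = 1 + K ^+ 2 ->
  atan K^-1 = asin (1 / rho).
Proof.
move=> K0 r0 rK.
have r1 : 1 < rho by rewrite -ltr_sqr ?nnegrE ?(ltW r0)// expr1n rK ltrDl exprn_gt0.
have y0 : 0 < 1 / rho by rewrite divr_gt0.
have y1 : 1 / rho < 1 by rewrite ltr_pdivrMr// mul1r.
have yB : -1 <= 1 / rho <= 1 by apply/andP; split; lra.
have Kr : cos (asin (1 / rho)) = K / rho.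
  rewrite cos_asin//; have -> : 1 - (1 / rho) ^+ 2 = (K / rho) ^+ 2.
    by rewrite !expr_div_n rK; field; rewrite -rK sqrf_eq0 gt_eqF.
  by rewrite sqrtr_sqr ger0_norm// divr_ge0// ltW.
have <- : tan (asin (1 / rho)) = K^-1.
  by rewrite /tan asinK ?in_itv//= Kr; field; rewrite !gt_eqF.
rewrite tanK// in_itv/= asin_gtNpi2 ?asin_ltpi2//; apply/andP; split; lra.
Qed.

Lemma atanV K : 0 < K -> atan K = pi / 2 - atan K^-1.
Proof.
move=> K0; have V0 : 0 < atan K^-1 by rewrite -(@atan0 R) lt_atan// invr_gt0.
have V1 := atan_ltpi2 K^-1.
rewrite -[RHS]tanK; last by rewrite in_itv/=; apply/andP; split; lra.
have -> : pi / 2 - atan K^-1 = - (atan K^-1 - pi / 2) by rewrite opprB.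
rewrite tanN /tan sinBpihalf cosBpihalf mulNr opprK; congr atan.
by rewrite -invf_div -/(tan (atan K^-1)) atanK invrK.
Qed.

End angles.

(** * Choice of the slope and assembly of the three estimates *)

Lemma tau_ge0 (R : realType) (B : set (R * R)) : (0 <= tau B)%E.
Proof. by apply: le_ereal_inf_tmp => _ [t [t0 _] <-]; rewrite lee_fin ltW. Qed.

Section tail_constants.
Variable R : realType.

(** [K] is the height at which the circle of radius [Rr + Num.sqrt 2] meets the line x = 1. *)
Lemma radius_sqr (Rr : R) : 2 < Rr ->
  exists2 K, 1 < K & (Rr + Num.sqrt 2) ^+ 2 = 1 + K ^+ 2.
Proof.
move=> R2; set rho := Rr + _.
have r2 : 2 < rho by rewrite ltr_wpDr ?sqrtr_ge0.
have r4 : 1 < rho ^+ 2 - 1 by nra.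
exists (Num.sqrt (rho ^+ 2 - 1)).
  by rewrite -[ltLHS]sqrtr1 ltr_sqrt//; lra.
by rewrite sqr_sqrtr ?subrKC//; lra.
Qed.

Lemma invr_powR (rho s : R) : 0 < rho -> (1 / rho) `^ (2 * s - 2) = rho `^ (2 - 2 * s).
Proof.
by move=> r0; rewrite div1r -powR_inv1 ?(ltW r0)// -powRrM mulN1r opprB.
Qed.

End tail_constants.

Theorem theorem5p13 (R : realType) (U : set (R * R)%type) :
  mildly_regular U ->
  interior (@Ddisc R) `<=` U ->
  @Ddisc R `<=` closure U ->
  (forall p, U p -> 0 < p.1) ->
  (forall p, closure U p -> (0 <= p.1 <= 1) /\ `|p.2| <= 2^-1) ->
  forall Rr : R, 2 < Rr ->
  [/\
   (* general infinite B contained in I_1, s > tau(B) *)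
   (forall (B : set (R * R)%type) (s : R) (v : R * R -> R),
      B `<=` @I1 R -> infinite_set B -> (tau B < s%:E)%E ->
      pos_eigenfunction U B s v ->
      forall z, closure U z ->
        ((CRs Rr s * v (0, 0))%:E *
           (\esum_(b in B `&` [set b | (Rr < ptmod b)%R]) ((ptmod b) `^ (- (2 * s)))%:E)
         <= \esum_(b in B `&` [set b | (Rr < ptmod b)%R])
              ((ptmod (ptadd z b)) `^ (- (2 * s)) * v (theta b z))%:E)%E),
   (* B = I_1, s > 1 *)
   (forall (s : R) (v : R * R -> R),
      1 < s -> pos_eigenfunction U (@I1 R) s v ->
      forall z, closure U z ->
        ((CRs Rr s * v (0, 0) * (pi - 2 * thetaR Rr) * (1 / (2 * s - 2))
            * (1 / (Rr + Num.sqrt 2)) `^ (2 * s - 2))%:E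
         <= \esum_(b in @I1 R `&` [set b | (Rr < ptmod b)%R])
              ((ptmod (ptadd z b)) `^ (- (2 * s)) * v (theta b z))%:E)%E) &
   (* B = I_2, s > 1 *)
   (forall (s : R) (v : R * R -> R),
      1 < s -> pos_eigenfunction U (@I2 R) s v ->
      forall z, closure U z ->
        ((CRs Rr s * v (0, 0) * (pi / 2 - 2 * thetaR Rr) * (1 / (2 * s - 2))
            * (1 / (Rr + Num.sqrt 2)) `^ (2 * s - 2))%:E
         <= \esum_(b in @I2 R `&` [set b | (Rr < ptmod b)%R])
              ((ptmod (ptadd z b)) `^ (- (2 * s)) * v (theta b z))%:E)%E)].
Proof.
move=> _ _ DU _ Ubox Rr R2.
have D0 : Ddisc (0 : R, 0 : R) by apply/DdiscE; rewrite /sqN /= expr0n/= addr0.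
have main B s v : B `<=` @I1 R -> B !=set0 -> 0 <= s -> pos_eigenfunction U B s v ->
    forall z, closure U z ->
    ((CRs Rr s * v (0, 0))%:E *
       (\esum_(b in B `&` [set b | (Rr < ptmod b)%R]) ((ptmod b) `^ (- (2 * s)))%:E)
     <= \esum_(b in B `&` [set b | (Rr < ptmod b)%R])
          ((ptmod (ptadd z b)) `^ (- (2 * s)) * v (theta b z))%:E)%E.
  by move=> BI B0 s0 v_eig z /Ubox[z1 z2];
    exact: (eigenfunction_tail_ge R2 BI B0 s0 DU v_eig z1 z2).
have c0 B s v : pos_eigenfunction U B s v -> 0 <= CRs Rr s * v (0, 0).
  move=> [_ [v0 _]]; rewrite !mulr_ge0 ?expR_ge0 ?powR_ge0//.
  by apply/ltW/v0/DU.
have [K K1 KE] := radius_sqr R2.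
have K0 : 0 < K by lra.
have r0 : 0 < Rr + Num.sqrt 2 by rewrite ltr_wpDr ?sqrtr_ge0//; lra.
have angle := atan_inv_asin K0 r0 KE.
split.
- move=> B s v BI Binf tau_s v_eig; apply: main => //.
    by apply/set0P/negP => /eqP B0; apply: Binf; rewrite B0.
  by rewrite -lee_fin (le_trans (tau_ge0 B))// ltW.
- move=> s v s1 v_eig z Uz; rewrite invr_powR// /thetaR -angle.
  have s0 : 0 <= s by lra.
  apply: le_trans (main _ _ _ (fun b Ib => Ib) _ s0 v_eig z Uz); last first.
    by exists (1, 0), 1%N, 0.
  have H := le_trans (half_plane_sum s1 R2 K0 KE) (half_plane_le_esum_I1 s _).
  apply: le_trans (lee_wpmul2l _ (H _)); rewrite ?lee_fin ?(c0 _ _ _ v_eig)//; last by lra.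
  (* The opening angle is 2 atan K = pi - 2 atan (1/K), with atan (1/K) = [thetaR Rr]. *)
  by rewrite (atanV K0) le_eqVlt; apply/orP; left; apply/eqP; field; lra.
- move=> s v s1 v_eig z Uz; rewrite invr_powR// /thetaR -angle.
  have s0 : 0 <= s by lra.
  apply: le_trans (main _ _ _ (@I2_sub_I1 R) _ s0 v_eig z Uz); last first.
    by exists (1, -1), 1%N, (-1).
  have H := le_trans (quadrant_sum s1 R2 K1 KE) (quadrant_le_esum_I2 s _).
  apply: le_trans (lee_wpmul2l _ (H _)); rewrite ?lee_fin ?(c0 _ _ _ v_eig)//; last by lra.
  (* Here the opening angle is atan K - atan (1/K) = pi/2 - 2 atan (1/K). *)
  by rewrite (atanV K0) le_eqVlt; apply/orP; left; apply/eqP; field; lra.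
Qed.
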